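(* For every player set $N=\{1,2,\ldots,n\}$ with $|N|>1$, the following assertions hold: (i) $\mathrm{SeCIG}^N \not\subseteq \mathrm{CIG}^N$; (ii) $\mathrm{CIG}^N \not\subseteq \mathrm{SeCIG}^N$; (iii) $\mathrm{SeCIG}^N \cap \mathrm{CIG}^N \neq \emptyset$.
   Context: Let $2^N$ be the power set of $N$ and $\mathbb{IR}$ the set of all closed real intervals $X=[\underline{X},\overline{X}]$. A (classical) cooperative game is a pair $(N,v)$ with $v:2^N\to\mathbb{R}$ and $v(\emptyset)=0$; it is convex if $v$ is supermodular, i.e. $v(T)+v(S)\le v(S\cup T)+v(S\cap T)$ for every $S,T\subseteq N$. A cooperative interval game is a pair $(N,w)$ with $w:2^N\to\mathbb{IR}$ and $w(\emptyset)=[0,0]$. Its border games are the cooperative games $(N,\underline{w})$ and $(N,\overline{w})$, where $\underline{w}(S)$ and $\overline{w}(S)$ are the lower and upper bound of $w(S)$; its length game is the cooperative game $(N,|w|)$ with $|w|(S)=\overline{w}(S)-\underline{w}(S)$. A selection of $(N,w)$ is a cooperative game $(N,v)$ with $v(S)\in w(S)$ for every $S\in 2^N$. $\mathrm{CIG}^N$ is the class of convex interval games on player set $N$: interval games whose two border games and length game are all convex. $\mathrm{SeCIG}^N$ is the class of selection convex interval games on player set $N$: interval games all of whose selections are convex games. *)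

(* Defs.v *)
From mathcomp Require Import all_boot all_order all_algebra.
From mathcomp Require Import classical_sets reals.

Set Implicit Arguments.
Unset Strict Implicit.
Unset Printing Implicit Defensive.

Import Order.TTheory GRing.Theory Num.Theory.
Local Open Scope ring_scope.

(* Closed real intervals: nonempty and bounded, represented by their bounds.
   Since [lo <= hi] is a boolean, two such intervals are equal as soon as
   their bounds are. *)
Record closed_itv (R : realType) := ClosedItv {
  lo : R;
  hi : R;
  lo_le_hi : lo <= hi
}.

Definition point_itv (R : realType) (x : R) : closed_itv R :=
  ClosedItv (lexx x).

(* The player set {1, ..., n} is 'I_n, numbered from 0; coalitions are the
   elements of {set 'I_n}. *)
Record game (R : realType) (n : nat) := Game {
  game_val :> {set 'I_n} -> R;
  game_val0 : game_val finset.set0 = 0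
}.

Record interval_game (R : realType) (n : nat) := IntervalGame {
  igame_val :> {set 'I_n} -> closed_itv R;
  igame_val0 : igame_val finset.set0 = point_itv 0
}.

Definition convex_game (R : realType) (n : nat) (v : game R n) : Prop :=
  forall S T : {set 'I_n}, v T + v S <= v (S :|: T) + v (S :&: T).

Section DerivedGames.
Variables (R : realType) (n : nat) (w : interval_game R n).

Fact lower_game_subproof : lo (w finset.set0) = 0.
Proof. by rewrite igame_val0. Qed.

Definition lower_game : game R n :=
  @Game R n (fun S => lo (w S)) lower_game_subproof.

Fact upper_game_subproof : hi (w finset.set0) = 0.
Proof. by rewrite igame_val0. Qed.

Definition upper_game : game R n :=
  @Game R n (fun S => hi (w S)) upper_game_subproof.

Fact length_game_subproof : hi (w finset.set0) - lo (w finset.set0) = 0.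
Proof. by rewrite igame_val0 subrr. Qed.

Definition length_game : game R n :=
  @Game R n (fun S => hi (w S) - lo (w S)) length_game_subproof.

Definition selection (v : game R n) : Prop :=
  forall S : {set 'I_n}, v S \in `[lo (w S), hi (w S)].

End DerivedGames.

Definition CIG (R : realType) (n : nat) : set (interval_game R n) :=
  fun w => [/\ convex_game (lower_game w),
               convex_game (upper_game w) &
               convex_game (length_game w)].

Definition SeCIG (R : realType) (n : nat) : set (interval_game R n) :=
  fun w => forall v : game R n, selection w v -> convex_game v.

(* Main.v *)
(* All three parts are witnessed by intervals depending only on |S|, except
   for one selection.  (i) [S |-> |S|^2 + [0, (|S| == 1)]]: the supermodularity
   defect of |S|^2 at incomparable S, T is 2|S \ T||T \ S| >= 2, which absorbs
   the freedom of at most 1 at each of S and T, but the length game violates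
   supermodularity at two distinct singletons.  (ii) [S |-> [0, |S|]] has
   additive border and length games, yet the indicator of a single singleton
   coalition is a nonconvex selection.  (iii) The null game. *)
Require Import Defs.
From mathcomp Require Import all_boot all_order all_algebra.
From mathcomp Require Import classical_sets reals.
From mathcomp Require Import zify lra.

Set Implicit Arguments.
Unset Strict Implicit.
Unset Printing Implicit Defensive.

Import Order.TTheory GRing.Theory Num.Theory.

Section Cardinals.
Variable T : finType.
Implicit Types A B : {set T}.

(** With a, b, c the sizes of [A :\: B], [B :\: A], [A :&: B], this is (a+b+c)^2 + c^2 = (a+c)^2 +
    (b+c)^2 + 2ab. *)
Lemma sqr_cardsUI A B :
  (#|A :|: B| ^ 2 + #|A :&: B| ^ 2 =
   #|A| ^ 2 + #|B| ^ 2 + 2 * (#|A :\: B| * #|B :\: A|))%N.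
Proof.
have UI := cardsUI A B; have IDA := cardsID B A; have IDB := cardsID A B.
rewrite [B :&: A]finset.setIC in IDB; nia.
Qed.

Lemma sqr_cardsUI_incomparable A B : ~~ (A \subset B) -> ~~ (B \subset A) ->
  (#|A| ^ 2 + #|B| ^ 2 + 2 <= #|A :|: B| ^ 2 + #|A :&: B| ^ 2)%N.
Proof.
rewrite -!finset.setD_eq0 -!card_gt0 => AB BA.
by rewrite sqr_cardsUI leq_add2l leq_pmulr // muln_gt0 AB.
Qed.

End Cardinals.

Local Open Scope ring_scope.

Section Witnesses.
Variables (R : realType) (n : nat).
Implicit Types (S T : {set 'I_n}) (v : game R n).

Lemma closed_itv_eq (X Y : closed_itv R) : lo X = lo Y -> hi X = hi Y -> X = Y.
Proof.
case: X Y => [a b ab] [c d cd] /= ac bd; subst.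
by congr ClosedItv; exact: bool_irrelevance.
Qed.

(** For comparable coalitions, union and intersection are the two coalitions themselves, so
    supermodularity is an equality. *)
Lemma convex_game_incomparable v :
  (forall S T, ~~ (S \subset T) -> ~~ (T \subset S) ->
    v T + v S <= v (S :|: T) + v (S :&: T)) -> convex_game v.
Proof.
move=> vP S T; have [ST|nST] := boolP (S \subset T).
  by rewrite (finset.setUidPr ST) (finset.setIidPl ST).
have [TS|nTS] := boolP (T \subset S); last exact: vP.
by rewrite (finset.setUidPl TS) (finset.setIidPr TS) addrC.
Qed.

Definition sqr_card_itv S : closed_itv R :=
  @ClosedItv R (#|S| ^ 2)%:R (#|S| ^ 2 + (#|S| == 1))%:R
    (etrans (ler_nat R _ _) (leq_addr _ _)).

Fact sqr_card_itv0 : sqr_card_itv finset.set0 = point_itv 0.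
Proof. by apply: closed_itv_eq; rewrite /= cards0. Qed.

Definition sqr_card_igame := IntervalGame sqr_card_itv0.

Definition card_itv S : closed_itv R := @ClosedItv R 0 #|S|%:R (ler0n R _).

Fact card_itv0 : card_itv finset.set0 = point_itv 0.
Proof. by apply: closed_itv_eq; rewrite /= ?cards0. Qed.

Definition card_igame := IntervalGame card_itv0.

Definition null_igame : interval_game R n :=
  @IntervalGame R n (fun=> point_itv 0) erefl.

Lemma sqr_card_igame_SeCIG : SeCIG sqr_card_igame.
Proof.
move=> v vw; apply: convex_game_incomparable => S T nST nTS.
have lov (U : {set 'I_n}) : (#|U| ^ 2)%:R <= v U by have := vw U; rewrite in_itv => /andP[].
(* Weakened to a slack of 1 at every coalition; used at [S] and [T], it costs the 2 that
   incomparability supplies. *)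
have hiv (U : {set 'I_n}) : v U <= (#|U| ^ 2)%:R + 1.
  have := vw U; rewrite in_itv => /andP[_ /le_trans]; apply.
  by rewrite /= natrD lerD2l lern1 leq_b1.
have := sqr_cardsUI_incomparable nST nTS; rewrite -(ler_nat R) !natrD.
have := lov (S :|: T); have := lov (S :&: T); have := hiv S; have := hiv T.
lra.
Qed.

Lemma card_igame_CIG : CIG card_igame.
Proof.
split=> S T /=; rewrite ?subr0 ?addr0 //;
  by rewrite -!natrD cardsUI addnC.
Qed.

(** Degenerate intervals leave a single selection, the zero game. *)
Lemma null_igame_SeCIG : SeCIG null_igame.
Proof.
move=> v v0 S T; have vE (U : {set 'I_n}) : v U = 0.
  by have := v0 U; rewrite in_itv /= -eq_le => /eqP.
by rewrite !vE.
Qed.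

Lemma null_igame_CIG : CIG null_igame.
Proof. by split=> S T /=; rewrite ?subrr. Qed.

Variables i j : 'I_n.

Fact indicator_game_subproof : (finset.set0 == [set i]%SET)%:R = 0 :> R.
Proof. by rewrite eq_sym -cards_eq0 cards1. Qed.

Definition indicator_game : game R n :=
  @Game R n (fun S => (S == [set i]%SET)%:R) indicator_game_subproof.

Lemma indicator_game_selection : selection card_igame indicator_game.
Proof.
move=> S; rewrite in_itv /= ler0n ler_nat.
by case: eqP => // ->; rewrite cards1.
Qed.

Hypothesis ij : i != j.

Lemma set1I_neq : ([set i] :&: [set j] = finset.set0)%SET.
Proof.
by apply/finset.setP=> k; rewrite !inE; case: eqP => // ->; exact: negbTE.
Qed.

Lemma sqr_card_igame_not_CIG : ~ CIG sqr_card_igame.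
Proof.
case=> _ _ /(_ [set i]%SET [set j]%SET).
(* By [ij] the union has two elements, so its interval has length 0; the inequality becomes 1 + 1 <=
   0. *)
rewrite /= set1I_neq cards0 !cards1 cards2 ij !natrD.
by rewrite -[(1%N == 1)%:R]/(1 : R); lra.
Qed.

Lemma indicator_game_not_convex : ~ convex_game indicator_game.
Proof.
move=> /(_ [set i]%SET [set j]%SET).
have -> : indicator_game ([set i] :|: [set j])%SET = 0.
  (* The union lies in the singleton of [i] only if [j] equals [i]. *)
  by rewrite /= eqEcard finset.subUset !finset.sub1set !inE eq_sym (negbTE ij) andbF.
rewrite set1I_neq game_val0 /= eqxx -[true%:R]/(1 : R).
(* The left side is 1 plus a nonnegative term, the right side is 0. *)
have := ler0n R ([set j] == [set i] :> {set 'I_n}); lra.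
Qed.

End Witnesses.

Local Open Scope classical_set_scope.

Theorem theorem6 (R : realType) (n : nat) (n_gt1 : (1 < n)%N) :
  [/\ ~ (@SeCIG R n `<=` @CIG R n),
      ~ (@CIG R n `<=` @SeCIG R n) &
      @SeCIG R n `&` @CIG R n <> set0].
Proof.
(* Players 0 and 1: [ltnW n_gt1] is read as a proof of 0 < n. *)
have ij : Ordinal (ltnW n_gt1) != Ordinal n_gt1 by [].
split=> [/(_ _ (@sqr_card_igame_SeCIG R n)) | sub | E].
- exact: sqr_card_igame_not_CIG ij.
- apply: (indicator_game_not_convex (R := R) ij).
  exact: sub (@card_igame_CIG R n) _ (indicator_game_selection _ _).
- have : (@SeCIG R n `&` @CIG R n) (null_igame R n).
    by split; [exact: null_igame_SeCIG | exact: null_igame_CIG].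
  by rewrite E.
Qed.
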